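(* Let $d\ge 2$, $0<r<1$, $\rho>0$, and let $\mu$ be the uniform probability measure on the unit sphere $S^{d-1}\subset\mathbb{R}^d$. Let $k(x,y)=\mathbf 1(\|x-y\|\le r)$ (Euclidean distance). Fix $x_0\in S^{d-1}$, let $M^s=\{y\in S^{d-1}:\|y-x_0\|\le r\}$, and let $v_0:S^{d-1}\to[0,1]$ be the unique measurable map with $v_0=1$ on $M^s$ and, for $x\in S^{d-1}\setminus M^s$, $$v_0(x)=\frac{\int_{M^s}k(x,y)d\mu(y)+\int_{S^{d-1}\setminus M^s}v_0(y)k(x,y)d\mu(y)}{\rho+\int_{S^{d-1}}k(x,y)d\mu(y)}.$$ Let $\angle(x,x')=\arccos\langle x,x'\rangle$ and let $r'\in[0,\pi]$ be the angle $\angle(x,x')$ for points with $\|x-x'\|=r$. Then there exists a function $f:[0,\pi]\to[0,1]$ such that (1) $v_0(x)=f(\angle(x_0,x))$ for all $x\in S^{d-1}$, and (2) $f(\theta)>f(\theta')$ for all $\theta,\theta'\in[0,\pi]$ with $\theta'>\theta+r'$.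
   Context: $v_0$ is called the grounded voltage function centered at $x_0$ with ground weight $\rho$, source radius $r$ and disk kernel of bandwidth $r$. *)

(* Defs.v *)
From HB Require Import structures.
From mathcomp Require Import all_boot all_order all_algebra.
From mathcomp Require Import all_classical all_reals all_analysis.
Set Implicit Arguments. Unset Strict Implicit. Unset Printing Implicit Defensive.
Import Order.TTheory GRing.Theory Num.Theory.
Local Open Scope ring_scope.
Local Open Scope classical_set_scope.

(* Points of R^d are d-tuples of reals; d.-tuple R carries the product
   (Borel) sigma-algebra from MathComp-Analysis. *)

Definition dotp (R : realType) (d : nat) (x y : d.-tuple R) : R :=
  \sum_(i < d) tnth x i * tnth y i.

Definition eucl_dist (R : realType) (d : nat) (x y : d.-tuple R) : R :=
  Num.sqrt (\sum_(i < d) (tnth x i - tnth y i) ^+ 2).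

Definition usphere (R : realType) (d : nat) : set (d.-tuple R) :=
  [set x | dotp x x = 1].
Arguments usphere R d : clear implicits.

Definition diskker (R : realType) (d : nat) (r : R) (x y : d.-tuple R) : R :=
  if eucl_dist x y <= r then 1 else 0.

Definition angle (R : realType) (d : nat) (x x' : d.-tuple R) : R :=
  acos (dotp x x').

Definition matact (R : realType) (d : nat) (Q : 'M[R]_d) (x : d.-tuple R)
  : d.-tuple R := [tuple \sum_(j < d) Q i j * tnth x j | i < d].

Definition orthogonal_mx (R : realType) (d : nat) (Q : 'M[R]_d) : Prop :=
  Q^T *m Q = 1%:M.

(* mu is the uniform probability measure on S^{d-1}: a probability measure
   on R^d carried by the usphere and invariant under every orthogonal map
   (the normalized surface / Haar measure, which is the unique such one). *)
Definition uniform_sphere_measure (R : realType) (d : nat)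
  (mu : probability (d.-tuple R) R) : Prop :=
  mu (usphere R d) = 1%:E /\
  forall Q : 'M[R]_d, orthogonal_mx Q ->
    forall A : set (d.-tuple R), measurable A ->
      mu (matact Q @^-1` A) = mu A.

(* Main.v *)
Require Import Defs.
From HB Require Import structures.
From mathcomp Require Import all_boot all_order all_algebra.
From mathcomp Require Import all_classical all_reals all_analysis.
From mathcomp Require Import measurable_realfun ring lra.
Import Order.TTheory GRing.Theory Num.Theory.
Local Open Scope ring_scope.
Local Open Scope classical_set_scope.

(* Write the equation as [v x * (rho + D) = \int_(cap x) v], where [D] is the
   mass of a cap, the same for all caps by symmetry.  For [x] and [x'] with [x']
   farther from [x0], averaging over the reflection exchanging [x] and [x'] shows
   that a bound [B] on the increments [v x' - v x] improves to [B / (1 + rho)];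
   hence no increment is positive, so [v] is a nonincreasing function of the
   angle to [x0].  Since caps have positive mass, positivity of [v] propagates
   from the source along a great circle.  Finally, if [x'] is at angle larger
   than [theta + r'], its whole cap lies beyond the angle [theta], and the ground
   weight makes [v x'] strictly less than the positive value of [v] at [theta]. *)

Set Implicit Arguments. Unset Strict Implicit.

(** Differences, rescalings, reflections and great circles are all instances of this one operation,
    so [dotpE] alone expands their inner products by bilinearity. *)
Definition lincomb {R : realType} {d : nat} (a : R) (x : d.-tuple R) (b : R)
  (y : d.-tuple R) : d.-tuple R := [tuple a * tnth x i + b * tnth y i | i < d].

(** * Inner products, distances and angles on the sphere *)

Section SphereGeometry.
Context {R : realType} {d : nat}.
Implicit Types (x y z e n : d.-tuple R) (a b c s t : R).

Lemma dotpC x y : dotp x y = dotp y x.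
Proof. by apply: eq_bigr => i _; rewrite mulrC. Qed.

Lemma dotp_lincombl a x b y z :
  dotp (lincomb a x b y) z = a * dotp x z + b * dotp y z.
Proof.
rewrite /dotp !big_distrr -big_split /=; apply: eq_bigr => i _.
by rewrite tnth_mktuple mulrDl !mulrA.
Qed.

Lemma dotp_lincombr a x b y z :
  dotp z (lincomb a x b y) = a * dotp z x + b * dotp z y.
Proof. by rewrite dotpC dotp_lincombl !(dotpC z). Qed.

Definition dotpE := (@dotp_lincombl, @dotp_lincombr).

Lemma dotp_ge0 x : 0 <= dotp x x.
Proof. by apply: sumr_ge0 => i _; rewrite -expr2 sqr_ge0. Qed.

Lemma dotp_sub_eq0 x y : dotp (lincomb 1 x (-1) y) (lincomb 1 x (-1) y) = 0 ->
  x = y.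
Proof.
move=> /eqP; rewrite psumr_eq0; last by move=> i _; rewrite -expr2 sqr_ge0.
move=> /allP h; apply: eq_from_tnth => i; apply/eqP.
have := h i (mem_index_enum i).
by rewrite tnth_mktuple mulf_eq0 orbb mul1r mulN1r subr_eq0.
Qed.

Lemma cauchy_schwarz_dotp x y : dotp x y ^+ 2 <= dotp x x * dotp y y.
Proof.
have h s t := dotp_ge0 (lincomb s x t y).
have {h} h s t : 0 <= s ^+ 2 * dotp x x + 2 * s * t * dotp x y + t ^+ 2 * dotp y y.
  by have := h s t; rewrite !dotpE (dotpC y x) => /le_trans; apply; lra.
move: (dotp_ge0 y) h.
move: (dotp x x) (dotp x y) (dotp y y) => a b c; rewrite le_eqVlt.
move=> /predU1P[<- h|c0 h]; last first.
  (* At [s = c], [t = - b] the quadratic form equals [c * (a * c - b ^+ 2)]. *)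
  by rewrite -subr_ge0 -(pmulr_rge0 _ c0); have := h c (- b); nra.
have [->|b0] := eqVneq b 0; first by rewrite expr0n/= mulr0.
(* When [dotp y y = 0] the form is affine in [t]; for [b != 0] this [t] would give it the value
   [-1]. *)
have := h 1 (- (a + 1) / (2 * b)).
have -> : 2 * 1 * (- (a + 1) / (2 * b)) * b = - (a + 1) by field.
by lra.
Qed.

Lemma dotp_bounds x y : usphere R d x -> usphere R d y -> -1 <= dotp x y <= 1.
Proof.
move=> xS yS; have := cauchy_schwarz_dotp x y.
rewrite xS yS mulr1 => h; nra.
Qed.

(** On the sphere the squared distance is [2 - 2 * dotp x y]; this turns the disk kernel into a
    condition on inner products. *)
Lemma eucl_dist_le x y r : usphere R d x -> usphere R d y -> 0 < r ->
  (eucl_dist x y <= r) = (1 - r ^+ 2 / 2 <= dotp x y).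
Proof.
move=> xS yS r0.
have -> : eucl_dist x y = Num.sqrt (2 - 2 * dotp x y).
  congr Num.sqrt.
  have -> : \sum_(i < d) (tnth x i - tnth y i) ^+ 2 =
      dotp (lincomb 1 x (-1) y) (lincomb 1 x (-1) y).
    by apply: eq_bigr => i _; rewrite !tnth_mktuple; ring.
  by rewrite !dotpE (dotpC y x) xS yS; ring.
rewrite -{1}(ger0_norm (ltW r0)) -sqrtr_sqr ler_sqrt ?sqr_ge0//.
by apply/idP/idP => h; lra.
Qed.

(* Gram: the components of [x] and [z] orthogonal to [y] satisfy Cauchy-Schwarz,
   which bounds [dotp x z] below by [cos (angle x y + angle y z)]. *)
Lemma angle_triangle x y z : usphere R d x -> usphere R d y -> usphere R d z ->
  angle x z <= angle x y + angle y z.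
Proof.
move=> xS yS zS; rewrite /angle.
have := dotp_bounds xS yS; have := dotp_bounds yS zS; have := dotp_bounds xS zS.
move: (cauchy_schwarz_dotp (lincomb 1 x (- dotp x y) y)
  (lincomb 1 z (- dotp y z) y)).
rewrite !dotpE (dotpC y x) (dotpC z y) xS yS zS.
move: (dotp x y) (dotp y z) (dotp x z) => a b c gram cI bI aI.
rewrite leNgt; apply/negP => lt_c.
have [aK bK cK] : [/\ cos (acos a) = a, cos (acos b) = b & cos (acos c) = c].
  by rewrite !acosK// in_itv.
have [A0 B0 C1] : [/\ 0 <= acos a, 0 <= acos b & acos c <= pi].
  by rewrite !acos_ge0// acos_lepi.
have /andP[_ Api] : 0 <= acos a <= pi by rewrite acos_ge0// acos_lepi.
have /andP[_ Bpi] : 0 <= acos b <= pi by rewrite acos_ge0// acos_lepi.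
have sA : 0 <= sin (acos a) by rewrite sin_ge0_pi// A0.
have sB : 0 <= sin (acos b) by rewrite sin_ge0_pi// B0.
(* Cosine decreases only on [[0, pi]]; the sum lies there because the negated goal puts it below
   [acos c]. *)
have : cos (acos c) < cos (acos a + acos b).
  by rewrite ltr_cos// in_itv/= ?acos_ge0// addr_ge0//= (le_trans (ltW lt_c)).
rewrite cosD aK bK cK.
have := cos2Dsin2 (acos a); have := cos2Dsin2 (acos b); rewrite aK bK.
move: (sin _) (sin _) sA sB => sb sa sa0 sb0 eb ea.
have -> : (sa * sb = Num.sqrt ((sa * sb) ^+ 2)) by rewrite sqrtr_sqr ger0_norm// mulr_ge0.
rewrite ltNge => /negP; apply.
rewrite lerBlDl -lerBlDr -[_ - c]opprB.
apply: (le_trans (ler_norm _)); rewrite normrN -sqrtr_sqr ler_wsqrtr//.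
have -> : (sa * sb) ^+ 2 = (1 - a ^+ 2) * (1 - b ^+ 2) by rewrite exprMn; nra.
by apply: le_trans (le_trans gram _); nra.
Qed.

Lemma angleC x y : angle x y = angle y x.
Proof. by rewrite /angle dotpC. Qed.

Lemma angle_le x y t : usphere R d x -> usphere R d y -> 0 <= t <= pi ->
  (angle x y <= t) = (cos t <= dotp x y).
Proof.
move=> xS yS t0pi; have dxy := dotp_bounds xS yS.
rewrite -[dotp x y in RHS]acosK ?in_itv//= !leNgt ltr_cos//= ?in_itv//=.
by rewrite acos_ge0// acos_lepi.
Qed.

Lemma angle_ge x y t : usphere R d x -> usphere R d y -> 0 <= t <= pi ->
  (t <= angle x y) = (dotp x y <= cos t).
Proof.
move=> xS yS t0pi; have dxy := dotp_bounds xS yS.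
rewrite -[dotp x y in RHS]acosK ?in_itv//= !leNgt ltr_cos//= ?in_itv//=.
by rewrite acos_ge0// acos_lepi.
Qed.

(** * Reflections in hyperplanes, with a normal that need not be a unit vector *)

Definition householder n y : d.-tuple R :=
  lincomb 1 y (- (2 * dotp n y / dotp n n)) n.

(** Invariance of the measure is stated for orthogonal matrices, so the reflection is written as
    [1 - (2 / |n|^2) n n^T]. This matrix is symmetric, and it squares to the identity because
    [n n^T] squares to [|n|^2 n n^T]. *)
Lemma householder_matact n : dotp n n != 0 ->
  exists2 Q : 'M[R]_d, orthogonal_mx Q & matact Q =1 householder n.
Proof.
move=> n0; set u : 'cV[R]_d := \col_i tnth n i.
have uu : u^T *m u = (dotp n n)%:M.
  apply/matrixP => i j; rewrite !mxE !ord1 eqxx mulr1n.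
  by apply: eq_bigr => k _; rewrite !mxE.
exists (1%:M - (2 / dotp n n) *: (u *m u^T)).
  set M := u *m u^T; set c := 2 / dotp n n.
  have MT : M^T = M by rewrite trmx_mul trmxK.
  have MM : M *m M = dotp n n *: M.
    by rewrite /M mulmxA -(mulmxA u) uu mul_mx_scalar -scalemxAl.
  rewrite /orthogonal_mx [(_ - _)^T]raddfB /= [(_ *: _)^T]linearZ /= MT trmx1.
  rewrite mulmxBl mul1mx mulmxBr mulmx1 -scalemxAl -scalemxAr MM !scalerA.
  have -> : c * c * dotp n n = c + c by rewrite /c; field.
  by rewrite scalerDl; apply/matrixP => i j; rewrite !mxE; ring.
move=> y; apply: eq_from_tnth => i; rewrite !tnth_mktuple.
under eq_bigr do rewrite !mxE big_ord1 !mxE mulrBl.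
rewrite sumrB (bigD1 i)//= eqxx mul1r big1 ?addr0 ?mul1r; last first.
  by move=> j /negbTE ji; rewrite eq_sym ji mul0r.
rewrite mulNr; congr (_ - _).
rewrite {2}/dotp big_distrr big_distrl big_distrl /=; apply: eq_bigr => j _; ring.
Qed.

Lemma dotp_householderl n x y : dotp (householder n x) y =
  dotp x y - 2 * dotp n x * dotp n y / dotp n n.
Proof. by rewrite !dotpE; ring. Qed.

Lemma dotp_householder n x y : dotp n n != 0 ->
  dotp (householder n x) (householder n y) = dotp x y.
Proof. by move=> n0; rewrite !dotpE (dotpC x n); field. Qed.

Lemma householderK n : dotp n n != 0 -> involutive (householder n).
Proof.
move=> n0 x; apply: eq_from_tnth => i.
by rewrite /householder !dotpE !tnth_mktuple; field.
Qed.

Lemma dotp_sub_neq0 x y : x != y ->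
  dotp (lincomb 1 x (-1) y) (lincomb 1 x (-1) y) != 0.
Proof. by apply: contraNN => /eqP/dotp_sub_eq0/eqP. Qed.

(** For [n = x - x'] with [x], [x'] of equal norm, [2 * dotp n x = dotp n n], so the reflection
    subtracts exactly [n] from [x]. *)
Lemma householder_swap x x' : usphere R d x -> usphere R d x' -> x != x' ->
  householder (lincomb 1 x (-1) x') x = x'.
Proof.
move=> xS xS' /dotp_sub_neq0; rewrite !dotpE (dotpC x' x) xS xS' => h.
apply: eq_from_tnth => i.
rewrite /householder tnth_mktuple !dotpE tnth_mktuple (dotpC x' x) xS xS'; field.
by apply: contra_neq h => h; rewrite -[RHS]h; ring.
Qed.

(** * Great circles parametrised by arc length, for orthonormal [x] and [e] *)

Definition geodesic x e t := lincomb (cos t) x (sin t) e.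

Lemma dotp_geodesic x e s t : usphere R d x -> usphere R d e -> dotp x e = 0 ->
  dotp (geodesic x e s) (geodesic x e t) = cos (s - t).
Proof.
by move=> xS eS xe; rewrite !dotpE (dotpC e) xe xS eS cosB; ring.
Qed.

Lemma geodesic0 x e : geodesic x e 0 = x.
Proof.
by apply: eq_from_tnth => i; rewrite tnth_mktuple cos0 sin0; ring.
Qed.

Lemma geodesic_usphere x e t : usphere R d x -> usphere R d e -> dotp x e = 0 ->
  usphere R d (geodesic x e t).
Proof. by move=> xS eS xe; rewrite /usphere/= dotp_geodesic// subrr cos0. Qed.

Lemma dotp_geodesic0 x e t : usphere R d x -> usphere R d e -> dotp x e = 0 ->
  dotp x (geodesic x e t) = cos t.
Proof. by move=> xS eS xe; rewrite -{1}(geodesic0 x e) dotp_geodesic// sub0r cosN. Qed.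

Lemma exists_orthogonal x : (2 <= d)%N -> exists2 e, usphere R d e & dotp x e = 0.
Proof.
move=> d2; pose i0 := Ordinal (ltnW d2); pose i1 := Ordinal d2.
(* A nonzero orthogonal vector suffices, since it can be normalised. With [a], [b] the first two
   coordinates of [x], the vector [(-b, a, 0, ...)] serves unless [a = 0], and then the first basis
   vector does. *)
have [u u0 xu] : exists2 u, dotp u u != 0 & dotp x u = 0; last first.
  have uge := dotp_ge0 u.
  exists (lincomb (Num.sqrt (dotp u u))^-1 u 0 u); last by rewrite !dotpE xu; ring.
  rewrite /usphere/= !dotpE -{3}(sqr_sqrtr uge); field.
  by rewrite sqrtr_eq0 -ltNge lt_neqAle eq_sym u0.
pose a := tnth x i0; pose b := tnth x i1.
pose delta i : d.-tuple R := [tuple (j == i)%:R | j < d].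
have dotp_delta y i : dotp y (delta i) = tnth y i.
  rewrite /dotp (bigD1 i)//= tnth_mktuple eqxx mulr1 big1 ?addr0// => j ji.
  by rewrite tnth_mktuple (negbTE ji) mulr0.
have [a0|a0] := eqVneq a 0.
  exists (delta i0); last by rewrite dotp_delta.
  by rewrite dotp_delta tnth_mktuple eqxx oner_eq0.
exists (lincomb (- b) (delta i0) a (delta i1)); last first.
  by rewrite !dotpE !dotp_delta; rewrite -/a -/b; ring.
rewrite !dotpE !dotp_delta !tnth_mktuple/= !mulr1 !mulr0 addr0 add0r mulrNN.
by rewrite gt_eqF// -!expr2; have : 0 < a ^+ 2; [rewrite exprn_even_gt0 | have := sqr_ge0 b; lra].
Qed.

End SphereGeometry.

(** The size is given by the cosine [c] of the angular radius, which makes membership a linear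
    inequality in [y]. *)
Definition cap {R : realType} {d : nat} (c : R) (x : d.-tuple R)
  : set (d.-tuple R) := [set y | usphere R d y /\ c <= dotp x y].

(** * Measurability of caps and reflections *)

Section Measurability.
Context {R : realType} {d : nat}.
Implicit Types (x y n : d.-tuple R) (c : R).

Lemma measurable_dotp x : measurable_fun [set: d.-tuple R] (dotp x).
Proof.
apply: measurable_sum => i; apply: measurable_funM => //.
exact: measurable_tnth.
Qed.

Lemma measurable_usphere : measurable (usphere R d).
Proof.
have m : measurable_fun [set: d.-tuple R] (fun x => dotp x x).
  by apply: measurable_sum => i; apply: measurable_funM; exact: measurable_tnth.
by rewrite -[usphere R d]setTI; apply: (m _ [set 1]).
Qed.

Lemma measurable_cap c x : measurable (cap c x).
Proof.
rewrite [cap c x](_ : _ = usphere R d `&` (setT `&` [set y | cst c y <= dotp x y])).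
  apply: measurableI; first exact: measurable_usphere.
  by apply: measurable_fun_le => //; exact: measurable_dotp.
by rewrite setTI.
Qed.

Lemma measurable_householder n : measurable_fun [set: d.-tuple R] (householder n).
Proof.
apply/measurable_fun_tnthP => i.
rewrite [_ \o _](_ : _ = fun y => tnth y i + cst (- (2 * tnth n i / dotp n n)) y * dotp n y).
  apply: measurable_funD; first exact: measurable_tnth.
  by apply: measurable_funM => //; exact: measurable_dotp.
by apply/funext => y /=; rewrite tnth_mktuple; ring.
Qed.

End Measurability.

(** * Integrals of bounded functions against a probability measure *)

Section BoundedIntegral.
Context {dd} {T : measurableType dd} {R : realType} (mu : probability T R).

Lemma bounded_integrable (f : T -> R) (M : R) : measurable_fun setT f ->
  (forall x, `|f x| <= M) -> mu.-integrable setT (EFin \o f).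
Proof.
move=> mf fM; apply: measurable_bounded_integrable => //.
  by rewrite ltey_eq fin_num_measure.
exists M; split; first exact: num_real.
by move=> N MN x _; exact: le_trans (fM x) (ltW MN).
Qed.

Lemma Rintegral_indic (A : set T) : measurable A ->
  \int[mu]_x \1_A x = fine (mu A).
Proof. by move=> mA; rewrite /Rintegral integral_indic// setIT. Qed.

Lemma fine_probability01 (A : set T) : measurable A ->
  0 <= fine (mu A) <= 1.
Proof.
move=> mA; rewrite fine_ge0//= -lee_fin fineK ?fin_num_measure//.
exact: probability_le1.
Qed.

End BoundedIntegral.

(** * Symmetry of the uniform measure and mass of caps *)

Section UniformMeasure.
Context {R : realType} {d : nat} (mu : probability (d.-tuple R) R).
Hypothesis hmu : uniform_sphere_measure mu.
Implicit Types (x y n : d.-tuple R) (c : R).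

Lemma measure_householder n (A : set (d.-tuple R)) : dotp n n != 0 -> measurable A ->
  mu (householder n @^-1` A) = mu A.
Proof.
move=> n0 mA; have [Q oQ Qn] := householder_matact n0.
by rewrite -(hmu.2 _ oQ _ mA); congr (mu _); apply/seteqP; split => y /=; rewrite Qn.
Qed.

Lemma Rintegral_householder n (f : d.-tuple R -> R) (M : R) : dotp n n != 0 ->
  measurable_fun setT f -> (forall x, `|f x| <= M) ->
  \int[mu]_y f (householder n y) = \int[mu]_y f y.
Proof.
move=> n0 mf fM; rewrite /Rintegral; congr fine.
have mr := @measurable_householder R d n.
transitivity (integral (pushforward mu (householder n)) setT (EFin \o f)).
  rewrite integral_pushforward //; first exact/measurable_EFinP.
  apply: (@bounded_integrable _ _ _ _ _ M) => [|x]; last exact: fM.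
  exact: measurableT_comp.
apply: eq_measure_integral => A mA _.
by have := measure_householder n0 mA.
Qed.

Lemma householder_usphere n y : dotp n n != 0 -> usphere R d (householder n y) <-> usphere R d y.
Proof. by move=> n0; rewrite /usphere/= dotp_householder. Qed.

Lemma cap_householder n c x y : dotp n n != 0 ->
  cap c (householder n x) (householder n y) <-> cap c x y.
Proof. by move=> n0; rewrite /cap /usphere/= !dotp_householder. Qed.

(** The reflection exchanging the two centers carries one cap onto the other. *)
Lemma measure_cap c x x' : usphere R d x -> usphere R d x' ->
  mu (cap c x) = mu (cap c x').
Proof.
move=> xS xS'; have [->//|xx'] := eqVneq x x'.
have n0 := dotp_sub_neq0 xx'; rewrite -(householder_swap xS xS' xx').
set n := lincomb _ _ _ _ in n0 *.
rewrite -[RHS](measure_householder n0); last exact: measurable_cap.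
by congr (mu _); apply/seteqP; split => y /=; move: (cap_householder c x y n0) => [].
Qed.

(** The squared distance [2 - 2 * dotp x y] is a sum of [d] squares, each at most [eps ^+ 2]. *)
Lemma close_dotp x y (eps : R) : usphere R d x -> usphere R d y ->
  (forall i, `|tnth x i - tnth y i| <= eps) -> 1 - d%:R * eps ^+ 2 / 2 <= dotp x y.
Proof.
move=> xS yS h.
have : dotp (lincomb 1 x (-1) y) (lincomb 1 x (-1) y) <= d%:R * eps ^+ 2.
  rewrite mulr_natl -[X in _ *+ X]card_ord -sumr_const; apply: ler_sum => i _.
  rewrite !tnth_mktuple mul1r mulN1r -expr2 -real_normK ?num_real//.
  by rewrite lerXn2r ?nnegrE// (le_trans _ (h i)).
by rewrite !dotpE (dotpC y x) xS yS; lra.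
Qed.

(* Otherwise all caps of this size are null by symmetry; countably many of them,
   one for each rational point near the sphere, cover the sphere. *)
Lemma measure_cap_gt0 c x : usphere R d x -> c < 1 -> (0 < mu (cap c x))%E.
Proof.
move=> xS c1; rewrite lt_neqAle measure_ge0 andbT; apply/eqP => /esym cap0.
have null x' : usphere R d x' -> mu.-negligible (cap c x').
  move=> xS'; apply/negligibleP; first exact: measurable_cap.
  exact: etrans (measure_cap c xS' xS) cap0.
(* This choice gives [eps < 1] and [d * eps <= 1 - c], hence [d * eps ^+ 2 / 2 <= 1 - c], as
   [close_dotp] requires. *)
pose eps : R := (1 - c) / (d%:R + 2 - c).
have d0 : (0 : R) <= d%:R by [].
have den0 : 0 < d%:R + 2 - c by lra.
have eps0 : 0 < eps by rewrite divr_gt0//; lra.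
have epsE : eps * (d%:R + 2 - c) = 1 - c by rewrite /eps divfK// gt_eqF.
have close : c <= 1 - d%:R * eps ^+ 2 / 2 by nra.
pose A (q : d.-tuple rat) : set (d.-tuple R) := [set y | usphere R d y /\
  forall i, `|tnth y i - ratr (tnth q i)| <= eps / 2].
pose F k := if unpickle k is Some q then A q else set0.
have nullF k : mu.-negligible (F k).
  rewrite /F; case: unpickle => [q|]; last exact: negligible_set0.
  (* The rational point [q] need not lie on the sphere, so the cap is centered at some point [x'] of
     [A q]; any two points of [A q] differ by at most [eps] in each coordinate. *)
  have [->|/set0P[x' [xS' xq]]] := eqVneq (A q) set0; first exact: negligible_set0.
  apply: negligibleS (null _ xS') => y [yS yq]; split => //.
  apply: le_trans close (close_dotp xS' yS _) => i.
  move: (xq i) (yq i); rewrite !ler_norml => /andP[? ?] /andP[? ?].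
  by apply/andP; split; lra.
have sub : usphere R d `<=` \bigcup_k F k.
  move=> y yS.
  have /choice[q yq] i : exists q : rat, `|tnth y i - ratr q| <= eps / 2.
    have [|q] := @rat_in_itvoo R (tnth y i - eps / 2) (tnth y i + eps / 2).
      by lra.
    rewrite in_itv/= => /andP[? ?]; exists q.
    by rewrite ler_norml; apply/andP; split; lra.
  exists (pickle [tuple q i | i < d]) => //; rewrite /F pickleK; split=> // i.
  by rewrite tnth_mktuple.
have /negligibleP : mu.-negligible (usphere R d).
  exact: negligibleS sub (negligible_bigcup nullF).
move=> /(_ measurable_usphere) S0; have := etrans (esym hmu.1) S0.
by move/eqP; rewrite onee_eq0.
Qed.

End UniformMeasure.

(** * Monotonicity of the voltage in the angle to the source *)

Section GroundedVoltage.
Context {R : realType} {d : nat} (mu : probability (d.-tuple R) R).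
Hypothesis hmu : uniform_sphere_measure mu.
(** [w] stands for the voltage extended by 0 off the sphere. In [w_eq] the denominator is cleared
    and the source term is absorbed into the integral, as [w = 1] on the source. *)
Variables (x0 : d.-tuple R) (c rho : R) (w : d.-tuple R -> R).
Hypothesis x0S : usphere R d x0.
Hypothesis rho_gt0 : 0 < rho.
Hypothesis w_meas : measurable_fun setT w.
Hypothesis w01 : forall y, 0 <= w y <= 1.
Hypothesis w_out : forall y, ~ usphere R d y -> w y = 0.
Hypothesis w_source : forall x, usphere R d x -> c <= dotp x0 x -> w x = 1.
Hypothesis w_eq : forall x, usphere R d x -> dotp x0 x < c ->
  w x * (rho + fine (mu (cap c x))) = \int[mu]_y (w y * \1_(cap c x) y).
Implicit Types x y a b : d.-tuple R.

Let deg01 x : 0 <= fine (mu (cap c x)) <= 1.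
Proof. exact: (fine_probability01 mu (measurable_cap c x)). Qed.

Let indic01 x y : 0 <= (\1_(cap c x) y : R) <= 1.
Proof. by rewrite indicE; case: (_ \in _) => /=; rewrite ?lexx ?ler01. Qed.

Let indic_meas x : measurable_fun setT (\1_(cap c x) : _ -> R).
Proof. by apply: measurable_indic; exact: measurable_cap. Qed.

Lemma w_cap_integrable x : mu.-integrable setT (EFin \o (fun y => w y * \1_(cap c x) y)).
Proof.
apply: (@bounded_integrable _ _ _ _ _ 1) => [|y].
  by apply: measurable_funM => //; exact: indic_meas.
have /andP[wy0 wy1] := w01 y; have /andP[iy0 iy1] := indic01 x y.
rewrite ger0_norm ?mulr_ge0//. by rewrite mulr_ile1.
Qed.

Lemma indic_cap_integrable x (k : R) :
  mu.-integrable setT (EFin \o (fun y => k * \1_(cap c x) y)).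
Proof.
apply: (@bounded_integrable _ _ _ _ _ `|k|) => [|y].
  by apply: measurable_funM => //; exact: indic_meas.
have /andP[? ?] := indic01 x y.
by rewrite normrM (ger0_norm (_ : 0 <= \1_(cap c x) y))// ler_piMr.
Qed.

Lemma Rintegral_cap x (k : R) :
  \int[mu]_y (k * \1_(cap c x) y) = k * fine (mu (cap c x)).
Proof.
have -> : k * fine (mu (cap c x)) = k * \int[mu]_y \1_(cap c x) y.
  by rewrite Rintegral_indic//; exact: measurable_cap.
rewrite RintegralZl//.
have := indic_cap_integrable x 1; congr (mu.-integrable _ _).
by apply/funext => y /=; rewrite mul1r.
Qed.

(* If [b] is farther from [x0] than [a], the reflection exchanging them sends
   points of the cap of [b] outside that of [a] closer to [x0]; averaging the
   equation over this reflection turns the bound [B] into one for [w b - w a]. *)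
Lemma increment_contraction (B : R) :
  (forall a b, usphere R d a -> usphere R d b -> dotp x0 b <= dotp x0 a ->
    w b - w a <= B) ->
  forall a b, usphere R d a -> usphere R d b -> dotp x0 b <= dotp x0 a ->
    w b - w a <= B / (1 + rho).
Proof.
move=> hB a b aS bS ab.
have B0 : 0 <= B by have := hB _ _ aS aS (lexx _); rewrite subrr.
have Br : 0 <= B / (1 + rho) by rewrite divr_ge0// addr_ge0// ltW.
have [a_src|a_far] := leP c (dotp x0 a).
  by apply: le_trans Br; have := w_source aS a_src; have /andP[] := w01 b; lra.
have [->|nab] := eqVneq a b; first by rewrite subrr.
have b_far := le_lt_trans ab a_far.
have := w_eq aS a_far; have := w_eq bS b_far.
have -> : fine (mu (cap c b)) = fine (mu (cap c a)) by congr fine; exact: measure_cap.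
have Da := deg01 a; set D := fine _ in Da * => eb ea.
pose g y := w y * \1_(cap c b) y - w y * \1_(cap c a) y.
have gI : \int[mu]_y g y = (w b - w a) * (rho + D).
  by rewrite RintegralB//; [rewrite -ea -eb; ring | exact: w_cap_integrable..].
have n0 := dotp_sub_neq0 nab; have swap := householder_swap aS bS nab.
have na : dotp (lincomb 1 a (-1) b) x0 = dotp x0 a - dotp x0 b.
  by rewrite !dotpE !(dotpC _ x0); ring.
have ny y : dotp (lincomb 1 a (-1) b) y = dotp a y - dotp b y.
  by rewrite !dotpE; ring.
have nn0 := dotp_ge0 (lincomb 1 a (-1) b).
set n := lincomb _ _ _ _ in n0 swap na ny nn0.
have swap' : householder n b = a by rewrite -swap householderK.
have gm : measurable_fun setT g.
  by apply: measurable_funB; apply: measurable_funM => //;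
    exact: indic_meas.
have gbound y : `|g y| <= 1.
  have /andP[? ?] := w01 y; have /andP[? ?] := indic01 a y.
  have /andP[? ?] := indic01 b y.
  by rewrite /g ler_norml; apply/andP; split; nra.
have gint : mu.-integrable setT (EFin \o g) by exact: (@bounded_integrable _ _ _ _ _ 1).
have gnint : mu.-integrable setT (EFin \o (g \o householder n)).
  apply: (@bounded_integrable _ _ _ _ _ 1) => [|y]; last exact: gbound.
  by apply: measurableT_comp => //; exact: measurable_householder.
have caps y : \1_(cap c b) (householder n y) = \1_(cap c a) y :> R.
  rewrite -swap !indicE; congr (_%:R); congr nat_of_bool.
  by apply/idP/idP; rewrite !inE => /(cap_householder _ _ _ n0).
have caps' y : \1_(cap c a) (householder n y) = \1_(cap c b) y :> R.
  by rewrite -caps householderK.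
(* For [y] nearer to [b] than to [a], the reflection adds a nonnegative multiple of [dotp n x0] to
   [dotp x0 y], so [hB] applies to the pair formed by the image of [y] and [y]. *)
have toward y : usphere R d y -> dotp a y < dotp b y ->
    w y - w (householder n y) <= B.
  move=> yS lt_ab; apply: hB => //; first exact/householder_usphere.
  rewrite dotpC (dotpC x0) dotp_householderl na ny lerBrDr gerDl.
  rewrite -mulrA; apply: mulr_le0_ge0; first by lra.
  by rewrite divr_ge0// subr_ge0.
have away y : usphere R d y -> dotp b y < dotp a y ->
    w (householder n y) - w y <= B.
  move=> yS lt_ab; rewrite -{2}(householderK n0 y); apply: toward.
    exact/householder_usphere.
  by rewrite -[in ltLHS]swap' -[in ltRHS]swap !dotp_householder.
(* With [y'] the image of [y], the left side is [w y - w y'] times the difference of the indicators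
   of the caps of [b] and [a] at [y]. It vanishes unless [y] lies in exactly one cap, where [toward]
   or [away] bounds it by [B]. *)
have pointwise y : g y + g (householder n y) <=
    B * \1_(cap c a) y + B * \1_(cap c b) y.
  rewrite /g caps caps'.
  have [yS|yS] := pselect (usphere R d y); last first.
    by rewrite !w_out// => [|/householder_usphere-/(_ n0)//]; have /andP[? ?] := indic01 a y;
      have /andP[? ?] := indic01 b y; nra.
  have Ecap x : \1_(cap c x) y = (c <= dotp x y)%R%:R :> R.
    rewrite indicE; congr (_%:R); congr nat_of_bool.
    by apply/idP/idP => [/set_mem[]|h]//; exact/mem_set.
  rewrite !Ecap.
  have [cb|cb] := leP c (dotp b y); have [ca|ca] := leP c (dotp a y) => /=;
    rewrite ?mulr1n ?mulr0n.
  - by lra.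
  - by have := toward y yS (lt_le_trans ca cb); lra.
  - by have := away y yS (lt_le_trans cb ca); lra.
  - by lra.
have lhs : \int[mu]_y (g y + g (householder n y)) = 2 * ((w b - w a) * (rho + D)).
  rewrite (@RintegralD _ _ _ mu setT g (g \o householder n))//=.
  by rewrite (Rintegral_householder hmu n0 gm gbound) gI; ring.
have rhs : \int[mu]_y (B * \1_(cap c a) y + B * \1_(cap c b) y) = 2 * (B * D).
  rewrite RintegralD//; try exact: indic_cap_integrable.
  rewrite !Rintegral_cap -/D.
  have -> : fine (mu (cap c b)) = D by congr fine; exact: measure_cap.
  by ring.
have : 2 * ((w b - w a) * (rho + D)) <= 2 * (B * D).
  rewrite -lhs -rhs; apply: le_Rintegral => //.
    exact: (integrableD measurableT gint gnint).
  exact: (integrableD measurableT (indic_cap_integrable a B)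
    (indic_cap_integrable b B)).
(* Since [D <= 1], adding [(1 - D) * (w b - w a) <= (1 - D) * B] to
   [(w b - w a) * (rho + D) <= B * D] yields the factor [1 + rho], free of [D]. *)
have := hB _ _ aS bS ab; have /andP[D0 D1] := Da.
rewrite ler_pdivlMr ?addr_gt0//; nra.
Qed.

(** The supremum of the increments is finite because [w] has values in [[0, 1]]. The contraction
    gives [sup E <= sup E / (1 + rho)], which forces [sup E <= 0]. *)
Lemma voltage_antitone a b : usphere R d a -> usphere R d b ->
  dotp x0 b <= dotp x0 a -> w b <= w a.
Proof.
pose E := [set t | exists a b, [/\ usphere R d a, usphere R d b,
  dotp x0 b <= dotp x0 a & t = w b - w a]].
have E0 : E 0 by exists x0, x0; rewrite subrr; split.
have supE : has_sup E.
  split; first by exists 0.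
  by exists 1 => _ [p [q [_ _ _ ->]]]; have := w01 p; have := w01 q; lra.
have le_sup p q : usphere R d p -> usphere R d q -> dotp x0 q <= dotp x0 p ->
    w q - w p <= sup E.
  by move=> pS qS pq; apply: ub_le_sup; [exact: supE.2 | exists p, q; split].
have : sup E <= sup E / (1 + rho).
  apply: ge_sup => [|_ [p [q [pS qS pq ->]]]]; first by exists 0.
  exact: increment_contraction.
rewrite ler_pdivlMr ?addr_gt0// mulrDr mulr1 gerDl pmulr_lle0// => sup_le0.
move=> aS bS ab; rewrite -subr_le0; exact: le_trans (le_sup _ _ aS bS ab) sup_le0.
Qed.

(** The part of the cap outside [A] contributes a nonnegative amount; this carries positivity from
    [A] to [x]. *)
Lemma le_mean (eps : R) (A : set (d.-tuple R)) x : usphere R d x -> dotp x0 x < c ->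
  measurable A -> A `<=` cap c x -> (forall y, A y -> eps <= w y) ->
  eps * fine (mu A) <= w x * (rho + fine (mu (cap c x))).
Proof.
move=> xS x_far mA Acap epsw; rewrite w_eq// -Rintegral_indic//.
have iA (k : R) : mu.-integrable setT (EFin \o (fun y => k * \1_A y)).
  apply: (@bounded_integrable _ _ _ _ _ `|k|) => [|y].
    by apply: measurable_funM => //; exact: measurable_indic.
  by rewrite normrM indicE normr_nat ler_piMr//; case: (_ \in _).
rewrite -RintegralZl//; last first.
  have := iA 1; congr (mu.-integrable _ _).
  by apply/funext => y /=; rewrite mul1r.
apply: le_Rintegral => // [|y _]; first exact: w_cap_integrable.
have /andP[wy0 _] := w01 y; have /andP[iy0 _] := indic01 x y.
have [yA|yA] := pselect (A y).
  by rewrite !indicE !mem_set//; [rewrite !mulr1; exact: epsw | exact: Acap].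
by rewrite [X in _ * X <= _]indicE memNset// mulr0 mulr_ge0.
Qed.

(** With [M > 0], the extra [rho] on the left makes [w x] strictly smaller than [M]. *)
Lemma mean_le (M : R) x : usphere R d x -> dotp x0 x < c ->
  (forall y, cap c x y -> w y <= M) ->
  w x * (rho + fine (mu (cap c x))) <= M * fine (mu (cap c x)).
Proof.
move=> xS x_far wM; rewrite w_eq// -Rintegral_cap.
apply: le_Rintegral => // [||y _]; [exact: w_cap_integrable|exact: indic_cap_integrable|].
have [yA|yA] := pselect (cap c x y).
  by rewrite !indicE !mem_set// !mulr1; exact: wM.
by rewrite !indicE memNset// !mulr0.
Qed.

(** * Positivity and strict decrease along a great circle from [x0], with [s] the angular radius of
    the caps *)

Variables (e : d.-tuple R) (s : R).
Hypothesis eS : usphere R d e.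
Hypothesis x0e : dotp x0 e = 0.
Hypothesis s_gt0 : 0 < s.
Hypothesis s_le_pi : s <= pi.
Hypothesis cE : c = cos s.
Let p := geodesic x0 e.

Let s0pi : 0 <= s <= pi. Proof. by rewrite s_le_pi ltW. Qed.

Let pS t : usphere R d (p t). Proof. exact: geodesic_usphere. Qed.

Let dotp_p t : dotp x0 (p t) = cos t. Proof. exact: dotp_geodesic0. Qed.

Let angle_p t : 0 <= t <= pi -> angle x0 (p t) = t.
Proof. by move=> t0pi; rewrite /angle dotp_p cosK. Qed.

Let p_source t : 0 <= t <= pi -> t <= s -> w (p t) = 1.
Proof.
move=> t0pi ts; apply: w_source; first exact: pS.
by rewrite cE -angle_le ?angle_p.
Qed.

Let p_far t : 0 <= t <= pi -> s < t -> dotp x0 (p t) < c.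
Proof.
by move=> t0pi st; rewrite ltNge cE -angle_le ?angle_p// -ltNge.
Qed.

Let cap_angle x y : usphere R d x -> cap c x y -> usphere R d y /\ angle x y <= s.
Proof.
by move=> xS [yS]; rewrite cE -angle_le.
Qed.

(* The cap of radius [s / 4] about [p (t - s / 2)] lies within [s] of [p t]
   and no farther from [x0] than [p (t - s / 4)]. *)
Lemma voltage_gt0_step t : s < t <= pi -> 0 < w (p (t - s / 4)) -> 0 < w (p t).
Proof.
have [s0 spi] := (s_gt0, s_le_pi).
move=> /andP[st tpi] w_gt0; have t0pi : 0 <= t <= pi by rewrite tpi andbT ltW// (lt_trans s_gt0).
pose z := p (t - s / 2).
have s4 : 0 <= s / 4 <= pi by apply/andP; split; lra.
have z0 : angle x0 z = t - s / 2 by apply: angle_p; apply/andP; split; lra.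
have zt : angle (p t) z = s / 2.
  rewrite /angle dotp_geodesic// (_ : t - _ = s / 2); last by ring.
  by apply: cosK; rewrite in_itv/=; apply/andP; split; lra.
have near_z y : cap (cos (s / 4)) z y -> usphere R d y /\ angle z y <= s / 4.
  by move=> [yS]; rewrite -(angle_le (pS _)).
have : w (p (t - s / 4)) * fine (mu (cap (cos (s / 4)) z)) <=
    w (p t) * (rho + fine (mu (cap c (p t)))).
  apply: le_mean => //; [exact: p_far|exact: measurable_cap| |].
    move=> y /near_z[yS zy]; split => //; rewrite cE -angle_le//.
    by apply: le_trans (angle_triangle (pS t) (pS (t - s / 2)) yS) _; lra.
  move=> y /near_z[yS zy]; apply: voltage_antitone => //.
  rewrite dotp_p -angle_le//; last by apply/andP; split; lra.
  by apply: le_trans (angle_triangle x0S (pS (t - s / 2)) yS) _; rewrite -/z; lra.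
have : 0 < fine (mu (cap (cos (s / 4)) z)).
  rewrite fine_gt0//; apply/andP; split; last by rewrite ltey_eq fin_num_measure//; exact: measurable_cap.
  apply: measure_cap_gt0 => //; first exact: pS.
  by rewrite -[ltRHS]cos0 ltr_cos ?in_itv/= ?s4 ?lexx ?pi_ge0//; lra.
have /andP[D0 _] := deg01 (p t); have /andP[w0 _] := w01 (p t).
move: (fine _) D0 (fine _) => D D0 m m0.
by rewrite lt_neqAle w0 andbT => h; apply/eqP => w00; move: h; rewrite -w00 mul0r leNgt mulr_gt0.
Qed.

(** Induction on the number of steps of length [s / 4] needed beyond the source, where [w = 1];
    finitely many reach [pi]. *)
Lemma voltage_gt0 t : 0 <= t <= pi -> 0 < w (p t).
Proof.
have [s0 spi] := (s_gt0, s_le_pi).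
have [n pi_n] : exists n : nat, pi <= s + n%:R * (s / 4).
  have s4 : 0 < s / 4 by rewrite divr_gt0.
  have q0 : 0 <= pi / (s / 4) by rewrite divr_ge0 ?pi_ge0// ltW.
  exists (Num.bound (pi / (s / 4))); have := archi_boundP q0.
  by rewrite ltr_pdivrMr//; lra.
move=> t0pi; have : t <= s + n%:R * (s / 4) by apply: le_trans pi_n; case/andP: t0pi.
clear pi_n; elim: n t t0pi => [|n IH] t t0pi t_le.
  by rewrite p_source//; lra.
have [ts|st] := leP t s; first by rewrite p_source.
apply: voltage_gt0_step; first by case/andP: t0pi => _ ->; rewrite st.
case/andP: t0pi => t0 tpi; apply: IH; first by apply/andP; split; lra.
by move: t_le; rewrite -natr1; lra.
Qed.

Lemma voltage_decreasing t t' : 0 <= t <= pi -> 0 <= t' <= pi -> t + s < t' ->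
  w (p t') < w (p t).
Proof.
have [s0 spi] := (s_gt0, s_le_pi).
move=> t0pi t'0pi tt'; have w_gt0 := voltage_gt0 t0pi.
case/andP: (t0pi) => t0 _; have rho0 := rho_gt0.
have : w (p t') * (rho + fine (mu (cap c (p t')))) <= w (p t) * fine (mu (cap c (p t'))).
  apply: mean_le => //; first by apply: p_far => //; lra.
  move=> y /cap_angle-/(_ (pS t'))[yS ty]; apply: voltage_antitone => //.
  rewrite dotp_p -angle_ge//.
  (* A point [y] of the cap of [p t'] has angle at least [t' - s > t] to [x0]. *)
  have := angle_triangle x0S yS (pS t'); rewrite angle_p// (angleC y); lra.
have /andP[D0 _] := deg01 (p t').
have /andP[w0 _] := w01 (p t').
rewrite ltNge => h; apply/negP => h'.
by have : 0 < w (p t) * rho; [rewrite mulr_gt0 | nra].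
Qed.

End GroundedVoltage.

(** * Reduction of the theorem to the voltage extended by zero *)

Unset Implicit Arguments. Set Strict Implicit.

Theorem theorem4 (R : realType) (d : nat) (hd : (2 <= d)%N)
  (r rho : R) (hr0 : 0 < r) (hr1 : r < 1) (hrho : 0 < rho)
  (mu : probability (d.-tuple R) R) (hmu : uniform_sphere_measure mu)
  (x0 : d.-tuple R) (hx0 : usphere R d x0)
  (v0 : d.-tuple R -> R)
  (Ms : set (d.-tuple R))
  (hMs : Ms = [set y | usphere R d y /\ eucl_dist y x0 <= r])
  (hv0m : measurable_fun (usphere R d) v0)
  (hv0r : forall x, usphere R d x -> 0 <= v0 x <= 1)
  (hv0s : forall x, Ms x -> v0 x = 1)
  (hv0eq : forall x, (usphere R d `\` Ms) x ->
     v0 x = (Rintegral mu Ms (fun y => diskker r x y)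
             + Rintegral mu (usphere R d `\` Ms) (fun y => v0 y * diskker r x y))
            / (rho + Rintegral mu (usphere R d) (fun y => diskker r x y))) :
  let r' := acos (1 - r ^+ 2 / 2) in
  exists f : R -> R,
    (forall t, 0 <= t <= pi -> 0 <= f t <= 1) /\
    (forall x, usphere R d x -> v0 x = f (angle x0 x)) /\
    (forall t t', 0 <= t <= pi -> 0 <= t' <= pi -> t' > t + r' -> f t > f t').
Proof.
move=> r'; pose c : R := 1 - r ^+ 2 / 2.
have cI : -1 <= c <= 1 by rewrite /c; apply/andP; split; nra.
have c_lt1 : -1 <= c < 1 by rewrite /c; apply/andP; split; nra.
have cE : c = cos r' by rewrite acosK// in_itv.
have r'0 : 0 < r' by rewrite acos_gt0.
have r'pi : r' <= pi by rewrite acos_lepi.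
have [e eS x0e] := exists_orthogonal x0 hd.
have MsE : Ms = cap c x0.
  rewrite hMs; apply/seteqP; split => y [yS h]; split => //.
    by rewrite dotpC -eucl_dist_le.
  by rewrite eucl_dist_le// dotpC.
have diskE x y : usphere R d x -> usphere R d y ->
    diskker r x y = \1_(cap c x) y.
  move=> xS yS; rewrite /diskker eucl_dist_le// indicE.
  case: ifPn => h; first by rewrite mem_set.
  by rewrite memNset// => -[_] /(negP h).
(* [v0] is constrained only on the sphere; extending it by 0 gives a function measurable and bounded
   on the whole space. *)
pose w : d.-tuple R -> R := patch (fun=> 0) (usphere R d) v0.
have wE y : usphere R d y -> w y = v0 y by move=> yS; rewrite /w patchE mem_set.
have w_out y : ~ usphere R d y -> w y = 0 by move=> yS; rewrite /w patchE memNset.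
have w01 y : 0 <= w y <= 1.
  have [yS|yS] := pselect (usphere R d y); first by rewrite wE// hv0r.
  by rewrite w_out// lexx ler01.
have w_meas : measurable_fun setT w.
  exact: (measurable_restrictT v0 measurable_usphere).1 hv0m.
have w_source x : usphere R d x -> c <= dotp x0 x -> w x = 1.
  by move=> xS cx; rewrite wE// hv0s// MsE.
have mS := @measurable_usphere R d.
have mMs : measurable Ms by rewrite MsE; exact: measurable_cap.
have MsS : Ms `<=` usphere R d by rewrite MsE => y [].
have w_eq x : usphere R d x -> dotp x0 x < c ->
    w x * (rho + fine (mu (cap c x))) = \int[mu]_y (w y * \1_(cap c x) y).
  move=> xS x_far.
  have : (usphere R d `\` Ms) x by split=> //; rewrite MsE => -[_]; rewrite leNgt x_far.
  move=> /hv0eq; rewrite -wE//.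
  have -> : Rintegral mu (usphere R d) (fun y => diskker r x y) = fine (mu (cap c x)).
    rewrite -Rintegral_indic; last exact: measurable_cap.
    rewrite Rintegral_mkcond; congr (Rintegral mu _ _); apply/funext => y.
    rewrite patchE; case: ifPn => [/set_mem yS|yS]; first exact: diskE.
    by rewrite indicE memNset// => -[/mem_set]; rewrite (negbTE yS).
  (* On the source [w = 1], so both integrals acquire the integrand [w y * \1_(cap c x) y] and merge
     into one over the sphere, then over the whole space. *)
  rewrite (@eq_Rintegral _ _ _ mu Ms (fun y => w y * \1_(cap c x) y)); last first.
    move=> y /set_mem yM; rewrite diskE ?wE ?hv0s ?mul1r//; exact: MsS.
  rewrite (@eq_Rintegral _ _ _ mu (usphere R d `\` Ms)
    (fun y => w y * \1_(cap c x) y)); last first.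
    by move=> y /set_mem[yS _]; rewrite diskE// wE.
  have wint : mu.-integrable setT (EFin \o (fun y => w y * \1_(cap c x) y)).
    exact: w_cap_integrable.
  rewrite -Rintegral_setU//; [|exact: measurableD|
    by rewrite setDUK//; exact: integrableS wint|]; last first.
    by apply/disj_setPS => y [yM [_ /(_ yM)]].
  rewrite setDUK// Rintegral_mkcond.
  rewrite [X in Rintegral mu setT X](_ : _ = fun y => w y * \1_(cap c x) y); last first.
    apply/funext => y; rewrite patchE; case: ifPn => // yS.
    by rewrite w_out ?mul0r// => /mem_set; rewrite (negbTE yS).
  move=> ->; rewrite divfK// gt_eqF// ltr_wpDr//.
  by have /andP[] := fine_probability01 mu (measurable_cap c x).
have pS t : usphere R d (geodesic x0 e t) by exact: geodesic_usphere.
(* [f] reads [v0] along one half great circle, which meets every angle to [x0]. *)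
exists (fun t => v0 (geodesic x0 e t)); split; [|split].
- by move=> t _; exact: hv0r.
- move=> x xS.
  have dE : dotp x0 (geodesic x0 e (angle x0 x)) = dotp x0 x.
    by rewrite dotp_geodesic0// acosK// in_itv/= dotp_bounds.
  rewrite -!wE//; apply/eqP; rewrite eq_le.
  (* Applied in both directions to two points at equal angle from [x0], monotonicity gives equality,
     that is, rotational symmetry. *)
  have anti := voltage_antitone hmu hx0 hrho w_meas w01 w_out w_source w_eq.
  by apply/andP; split; apply: anti => //; rewrite dE.
- move=> t t' tI t'I tt'; rewrite -!wE//.
  have decr := voltage_decreasing hmu hx0 hrho w_meas w01 w_out w_source w_eq.
  exact: (decr _ _ eS x0e r'0 r'pi cE _ _ tI t'I tt').
Qed.
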